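(* (Type $q$-P$(A_1^{(1)})$.) Let $$L_1=\frac{g\nu_1\nu_2\nu_3\nu_4}{f}-\frac{z}{qg}+\frac{\nu_1\nu_2\nu_3(\frac zq-\nu_4)}{f-\frac zq}(g-T_z^{-1})+\frac{z(z-\frac{\kappa_1}{\nu_8})}{q(f-z)}\Bigl(T_z-\frac1g\Bigr).$$ If $f=\nu_4$, then the equation $L_1y(z)=0$ is equivalent to $$z\Bigl(z-\frac{\kappa_1}{\nu_8}\Bigr)y(qz)+dz\,y(z)-q\nu_1\nu_2\nu_3(z-\nu_4)y(z/q)=0,\qquad d=\frac{\kappa_1-\nu_4\nu_8}{\nu_8}\frac1g .$$
   Context: $q,\kappa_1,\kappa_2,\nu_1,\dots,\nu_8,f,g$ are nonzero complex numbers with $\kappa_1^2\kappa_2^2=q\nu_1\nu_2\cdots\nu_8$. $T_z$ is the $q$-shift operator $T_zy(z)=y(qz)$, $T_z^{-1}y(z)=y(z/q)$. ($L_1$ is an operator of the Kajiwara–Noumi–Yamada Lax pair for $q$-P$(A_1^{(1)})$.) Equations are regarded as linear $q$-difference equations with coefficients rational in $z$, ''equivalent'' meaning equal up to multiplication by a nonzero rational function of $z$. *)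

(* Defs.v *)
From HB Require Import structures.
From mathcomp Require Import all_boot all_order all_algebra.
From mathcomp Require Import fraction complex.
From mathcomp Require Import boolp functions reals.
Set Implicit Arguments.
Unset Strict Implicit.
Unset Printing Implicit Defensive.
Import GRing.Theory.
Local Open Scope ring_scope.

Notation ratfun K := {fraction {poly K}}.
Notation "c %:PF" := (FracField.tofrac (c%:P))
  (at level 1, left associativity, format "c %:PF") : ring_scope.
Notation zvar := (FracField.tofrac 'X).

(* The substitution a(z) |-> a(q z) on K(z).  It is computed on a chosen
   representative; [qshift_frac] shows that for q != 0 the choice is
   irrelevant. *)
Definition scalevar (K : fieldType) (q : K) (p : {poly K}) : {poly K} :=
  p \Po (q *: 'X).

Definition qshift (K : fieldType) (q : K) (a : ratfun K) : ratfun K :=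
  FracField.tofrac (scalevar q (frac (repr a)).1)
    / FracField.tofrac (scalevar q (frac (repr a)).2).

(* A space of functions y(z) on which linear q-difference operators with
   coefficients in K(z) act: a K(z)-vector space with the invertible operator
   (T_z y)(z) = y(q z), which satisfies T_z (a y) = a(q z) T_z y.  Meromorphic
   functions on C^* are the typical example; for rational functions see
   [ratfun_qspace] below. *)
Record qspace (K : fieldType) (q : K) := QSpace {
  qcarrier :> lmodType (ratfun K);
  qT : qcarrier -> qcarrier;
  qTV : qcarrier -> qcarrier;
  qTD : {morph qT : y1 y2 / y1 + y2};
  qTZ : forall a y, qT (a *: y) = qshift q a *: qT y;
  qTK : cancel qT qTV;
  qTVK : cancel qTV qT
}.
Arguments qT {K q M} y : rename.
Arguments qTV {K q M} y : rename.

(* An operator is given by its action on every space of functions, so that an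
   identity between operators is an identity between their coefficients in
   K(z), also when q is a root of unity: see [qequiv3P] below. *)
Definition qoperator (K : fieldType) (q : K) := forall M : qspace q, M -> M.

(* Equivalence of the equations A y = 0 and B y = 0. *)
Definition qequiv (K : fieldType) (q : K) (A B : qoperator q) : Prop :=
  exists r : ratfun K, r != 0 /\
    forall (M : qspace q) (y : M), A M y = r *: B M y.

Definition L1 (K : fieldType) (q kappa1 nu1 nu2 nu3 nu4 nu8 f g : K) :
    qoperator q := fun M y =>
  let z : ratfun K := zvar in
  ((g * nu1 * nu2 * nu3 * nu4 / f)%:PF - z / (q * g)%:PF) *: y
  + ((nu1 * nu2 * nu3)%:PF * (z / q%:PF - nu4%:PF) / (f%:PF - z / q%:PF))
      *: (g%:PF *: y - qTV y)
  + (z * (z - (kappa1 / nu8)%:PF) / (q%:PF * (f%:PF - z)))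
      *: (qT y - (1 / g)%:PF *: y).
Arguments L1 {K} q kappa1 nu1 nu2 nu3 nu4 nu8 f g M y.

Definition threeterm (K : fieldType) (q : K) (a b c : ratfun K) :
    qoperator q := fun M y => a *: qT y + b *: y + c *: qTV y.
Arguments threeterm {K q} a b c M y.

Section ShiftTheory.
Variable K : fieldType.
Implicit Types (q : K) (p : {poly K}) (a b : ratfun K).
Local Notation tf := (@FracField.tofrac {poly K}).

Lemma tofrac_neq0 p : p != 0 -> tf p != 0.
Proof. by rewrite tofrac_eq0. Qed.

Lemma ratfunE a : a = tf (frac (repr a)).1 / tf (frac (repr a)).2.
Proof.
have d0 := denom_ratioP (repr a).
apply: (mulIf (tofrac_neq0 d0)); rewrite mulfVK ?tofrac_neq0 //.
rewrite -{1}[a]reprK; unlock FracField.tofrac.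
rewrite -[LHS]FracField.pi_mul; apply/eqmodP; rewrite /= FracField.equivfE.
rewrite /FracField.mulf !numden_Ratio ?oner_neq0 ?mulr1 //.
by rewrite mulrC.
Qed.

Lemma scalevar_eq0 q p : q != 0 -> (scalevar q p == 0) = (p == 0).
Proof.
move=> q0; rewrite /scalevar -!size_poly_eq0 size_comp_poly2 //.
by rewrite size_scale // size_polyX.
Qed.

Lemma qshift_frac q n d : q != 0 -> d != 0 ->
  qshift q (tf n / tf d) = tf (scalevar q n) / tf (scalevar q d).
Proof.
move=> q0 d0; set a := tf n / tf d.
have e0 := denom_ratioP (repr a); have /eqP := ratfunE a.
rewrite {1}/a eqr_div ?tofrac_neq0 // -!tofracM tofrac_eq => /eqP e.
apply/eqP; rewrite eqr_div ?tofrac_neq0 ?scalevar_eq0 //.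
by rewrite -!tofracM tofrac_eq /scalevar -!comp_polyM -e [n * _]mulrC mulrC.
Qed.

Lemma ratfun_ind (P : ratfun K -> Prop) :
  (forall n d, d != 0 -> P (tf n / tf d)) -> forall a, P a.
Proof. by move=> h a; rewrite (ratfunE a); apply: h; exact: denom_ratioP. Qed.

Lemma qshift_tofrac q p : q != 0 -> qshift q (tf p) = tf (scalevar q p).
Proof.
move=> q0; have := qshift_frac p q0 (oner_neq0 _).
by rewrite /scalevar comp_polyC !tofrac1 !divr1.
Qed.

Lemma qshiftD q : q != 0 -> {morph qshift q : a b / a + b}.
Proof.
move=> q0 a b; elim/ratfun_ind: a => n d d0; elim/ratfun_ind: b => m e e0.
rewrite addf_div ?tofrac_neq0 // -!tofracM -tofracD !qshift_frac ?mulf_neq0 //.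
rewrite addf_div ?tofrac_neq0 ?scalevar_eq0 // -!tofracM -tofracD.
by rewrite /scalevar comp_polyD !comp_polyM.
Qed.

Lemma qshiftM q : q != 0 -> {morph qshift q : a b / a * b}.
Proof.
move=> q0 a b; elim/ratfun_ind: a => n d d0; elim/ratfun_ind: b => m e e0.
rewrite mulf_div -!tofracM !qshift_frac ?mulf_neq0 //.
by rewrite mulf_div -!tofracM /scalevar !comp_polyM.
Qed.

Lemma qshiftK q : q != 0 -> cancel (qshift q) (qshift q^-1).
Proof.
move=> q0 a; elim/ratfun_ind: a => n d d0.
rewrite !qshift_frac ?invr_eq0 ?scalevar_eq0 // /scalevar -!comp_polyA.
have -> : (q *: 'X) \Po (q^-1 *: 'X) = 'X :> {poly K}.
  by rewrite linearZ /= comp_polyX scalerA divff // scale1r.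
by rewrite !comp_polyXr.
Qed.

Lemma qshiftVK q : q != 0 -> cancel (qshift q^-1) (qshift q).
Proof. by move=> q0 a; rewrite -{1}[q]invrK qshiftK // invr_eq0. Qed.

Definition ratfun_qspace q (q0 : q != 0) : qspace q :=
  @QSpace K q (ratfun K)^o (qshift q) (qshift q^-1)
    (qshiftD q0) (qshiftM q0) (qshiftK q0) (qshiftVK q0).

(* The sequences y(q^k z), k : int, with independent terms. *)
Definition seq_qspace q (q0 : q != 0) : qspace q.
Proof.
apply: (@QSpace K q (int -> (ratfun K)^o)
  (fun m k => qshift q (m (k - 1))) (fun m k => qshift q^-1 (m (k + 1)))).
- by move=> m m'; apply/funext => k; rewrite !fctE qshiftD.
- by move=> a m; apply/funext => k; exact: qshiftM.
- by move=> m; apply/funext => k; rewrite qshiftK // addrK.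
- by move=> m; apply/funext => k; rewrite qshiftVK // subrK.
Defined.

Lemma qequiv3P q (a b c a' b' c' : ratfun K) : q != 0 ->
  qequiv (threeterm (q := q) a b c) (threeterm a' b' c') <->
  exists r : ratfun K,
    [/\ r != 0, a = r * a', b = r * b' & c = r * c'].
Proof.
move=> q0; split=> [[r [r0 E]]|[r [r0 -> -> ->]]]; exists r; last first.
  by split=> // M y; rewrite /threeterm !scalerDr !scalerA.
pose dlt : int -> (ratfun K)^o := fun k => if k == 0 then 1 else 0.
have s1 (p : K) : p != 0 -> qshift p 1 = 1.
  by move=> p0; rewrite -tofrac1 qshift_tofrac // /scalevar comp_polyC.
have s0 (p : K) : p != 0 -> qshift p 0 = 0.
  by move=> p0; rewrite -tofrac0 qshift_tofrac // /scalevar comp_poly0.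
have qV0 : q^-1 != 0 by rewrite invr_eq0.
have {}E k := congr1 (@^~ k) (E (seq_qspace q0) dlt).
have E3 (k : int) : a * qshift q (dlt (k - 1)) + b * dlt k
    + c * qshift q^-1 (dlt (k + 1))
  = r * (a' * qshift q (dlt (k - 1)) + b' * dlt k
    + c' * qshift q^-1 (dlt (k + 1))) := E k.
have := (E3 1, E3 0, E3 (-1)); rewrite /dlt /= !s1 // !s0 // => -[[]].
by rewrite !(mulr1, mulr0, addr0, add0r).
Qed.

End ShiftTheory.

(* Main.v *)
Require Import Defs.
From mathcomp Require Import all_boot all_algebra.
From mathcomp Require Import fraction complex reals.
From mathcomp Require Import ring.
Import GRing.Theory.
Local Open Scope ring_scope.

(* For f = nu4 the factor (z/q - nu4) / (f - z/q) of L1 is -1, so that L1 has no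
   pole at z = q f.  Multiplying by the remaining denominator q (f - z) gives
   the second equation. *)

(** With the third term of [L1] reduced to [- nu1 nu2 nu3 (g - T_z^-1)], its [g nu1 nu2 nu3] cancels
    the first constant. What multiplies [y] is then [-z/(q g)] times [1 + (z - kappa1/nu8)/(f - z) =
    (f - kappa1/nu8)/(f - z)], which is [d z / (q (f - z))]. The shifts occur only to the right of
    coefficients, so [lax_reduction] proves this for arbitrary vectors over a field, and [L1_equiv]
    takes that field to be [K(z)]. *)

Lemma fracC_eq0 (K : fieldType) (a : K) : (a%:PF == 0) = (a == 0).
Proof. by rewrite tofrac_eq0 polyC_eq0. Qed.

(** The convention that 0 has inverse 0 covers [b = 0], so rewriting with this creates no side
    conditions. *)
Lemma fracC_div (K : fieldType) (a b : K) : (a / b)%:PF = a%:PF / b%:PF.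
Proof.
have [->|b0] := eqVneq b 0.
  by rewrite polyC0 tofrac0 !invr0 !mulr0 polyC0 tofrac0.
have bF : b%:PF != 0 by rewrite fracC_eq0.
by apply: (mulIf bF); rewrite -tofracM -polyCM !divfK.
Qed.

Lemma fracC_subX_neq0 (K : fieldType) (a : K) : a%:PF - zvar != 0.
Proof. by rewrite -tofracB tofrac_eq0 -opprB oppr_eq0 polyXsubC_eq0. Qed.

Lemma lax_combE (F : pzRingType) (V : lmodType F) (A B C g h : F) (y v w : V) :
  A *: y + B *: (g *: y - w) + C *: (v - h *: y)
  = C *: v + (A + B * g - C * h) *: y - B *: w.
Proof.
rewrite !scalerBr !scalerA scalerBl scalerDl.
by rewrite !addrA [LHS](ACl (4*1*2*5*3)).
Qed.

(** Here [v] and [w] stand for [T_z y] and [T_z^-1 y]. With [z] an abstract scalar, only identities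
    between field elements remain. *)
Lemma lax_reduction (F : fieldType) (V : lmodType F)
    (q k n1 n2 n3 f n8 g z : F) (y v w : V) :
    q != 0 -> f != 0 -> n8 != 0 -> g != 0 -> f - z != 0 -> q * f - z != 0 ->
  (g * n1 * n2 * n3 * f / f - z / (q * g)) *: y
  + (n1 * n2 * n3 * (z / q - f) / (f - z / q)) *: (g *: y - w)
  + (z * (z - k / n8) / (q * (f - z))) *: (v - (1 / g) *: y)
  = (q * (f - z))^-1 *:
    ((z * (z - k / n8)) *: v + ((k - f * n8) / n8 * (1 / g) * z) *: y
     - (q * n1 * n2 * n3 * (z - f)) *: w).
Proof.
move=> q0 f0 n80 g0 fz0 qfz0.
have fzq0 : f - z / q != 0.
  apply: contraNneq qfz0 => fzq.
  by rewrite -[z](divfK q0) [_ / q * q]mulrC -mulrBr fzq mulr0.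
have -> : z / q - f = - (f - z / q) by rewrite opprB.
rewrite mulrN mulNr (mulfK fzq0) lax_combE scalerBr scalerDr !scalerA.
(* The coefficients of [v], [y] and [w] are compared separately; the cancellation producing [d] is
   the one for [y]. *)
congr (_ *: _ + _ *: _ - _ *: _).
- exact: mulrC.
- by field; rewrite ?q0 ?f0 ?n80 ?g0 ?fz0.
- by field; rewrite ?q0 ?fz0.
Qed.

Lemma L1_equiv (K : fieldType) (q kappa1 nu1 nu2 nu3 nu4 nu8 g : K) :
    q != 0 -> nu4 != 0 -> nu8 != 0 -> g != 0 ->
  let z : ratfun K := zvar in
  let d : K := (kappa1 - nu4 * nu8) / nu8 * (1 / g) in
  qequiv (L1 q kappa1 nu1 nu2 nu3 nu4 nu8 nu4 g)
    (fun M y => (z * (z - (kappa1 / nu8)%:PF)) *: qT y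
                + (d%:PF * z) *: y
                - ((q * nu1 * nu2 * nu3)%:PF * (z - nu4%:PF)) *: qTV y).
Proof.
move=> q0 nu40 nu80 g0 z d; exists (q%:PF * (nu4%:PF - z))^-1.
have fz0 : nu4%:PF - z != 0 := fracC_subX_neq0 _ nu4.
have qfz0 : q%:PF * nu4%:PF - z != 0.
  by rewrite -tofracM -polyCM fracC_subX_neq0.
(* The conditions on the constants are moved to [K(z)], where [lax_reduction] is applied. *)
rewrite -fracC_eq0 in q0; rewrite -fracC_eq0 in nu40.
rewrite -fracC_eq0 in nu80; rewrite -fracC_eq0 in g0.
split=> [|M y]; first by rewrite invr_eq0; exact: mulf_neq0 q0 fz0.
rewrite /L1 -/z /d !(fracC_div, polyCM, polyCB, tofracM, tofracB).
rewrite polyC1 tofrac1 lax_reduction.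
- reflexivity.
- exact: q0.
- exact: nu40.
- exact: nu80.
- exact: g0.
- exact: fz0.
- exact: qfz0.
Qed.

Theorem mainTheorem15 (R : realType)
    (q kappa1 kappa2 nu1 nu2 nu3 nu4 nu5 nu6 nu7 nu8 f g : R[i])
    (q0 : q != 0) (kappa10 : kappa1 != 0) (kappa20 : kappa2 != 0)
    (nu10 : nu1 != 0) (nu20 : nu2 != 0) (nu30 : nu3 != 0) (nu40 : nu4 != 0)
    (nu50 : nu5 != 0) (nu60 : nu6 != 0) (nu70 : nu7 != 0) (nu80 : nu8 != 0)
    (f0 : f != 0) (g0 : g != 0)
    (kappa_nu : kappa1 ^+ 2 * kappa2 ^+ 2
                = q * (nu1 * nu2 * nu3 * nu4 * nu5 * nu6 * nu7 * nu8)) :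
  f = nu4 ->
  let z : ratfun R[i] := zvar in
  let d : R[i] := (kappa1 - nu4 * nu8) / nu8 * (1 / g) in
  qequiv (L1 q kappa1 nu1 nu2 nu3 nu4 nu8 f g)
    (fun M y => (z * (z - (kappa1 / nu8)%:PF)) *: qT y
                + (d%:PF * z) *: y
                - ((q * nu1 * nu2 * nu3)%:PF * (z - nu4%:PF)) *: qTV y).
Proof. by move=> ->; exact: L1_equiv. Qed.
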